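(* Let $d \ge 2$ and $M, k \ge 1$ be integers. Let $f$ be chosen uniformly at random from the finite set $L_M(d,k)$, and let $v_0$ denote the root of $T(d,k)$. Then for every integer $t \ge 1$, $$\Pr( f(v_0) = M+t ) \le (9/10)^{d^{\lfloor (t-1)/M \rfloor}} \cdot \Pr( f(v_0) = 0).$$ Moreover, if $d \ge 3$, then the constant $9/10$ above may be replaced by $(3/4)^d$, that is, for every integer $t \ge 1$, $$\Pr( f(v_0) = M+t ) \le \left((3/4)^d\right)^{d^{\lfloor (t-1)/M \rfloor}} \cdot \Pr( f(v_0) = 0).$$ In addition (for all $d \ge 2$), $$\Pr ( f(v_0) = 0 ) \leq \frac{1}{1+2^{1-d}M}.$$
   Context: $T(d,k)$ is the rooted $d$-ary tree of depth $k$: every non-leaf vertex, including the root, has exactly $d$ children, and all leaves are at distance $k$ from the root $v_0$. For an integer $M \ge 1$, an integer-valued function $f$ on the vertices of a graph is called $M$-Lipschitz if $|f(u)-f(v)| \le M$ for every two adjacent vertices $u$ and $v$. $L_M(d,k)$ is the (finite) set of all integer-valued $M$-Lipschitz functions on the vertices of $T(d,k)$ that take the value zero on all leaves. *)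

(* Defs.v *)
From mathcomp Require Export all_boot all_order all_algebra finmap.
From mathcomp Require Export boolp classical_sets cardinality.
Set Implicit Arguments.
Unset Strict Implicit.
Unset Printing Implicit Defensive.
Import Order.TTheory GRing.Theory Num.Theory.
Local Open Scope classical_set_scope.
Local Open Scope ring_scope.

(* A vertex of T(d,k) is encoded by the path leading to it from the root: the
   word of length at most k over {0, ..., d-1} listing the successive choices
   of a child. Its length is its distance from the root. *)
Notation tree d k := (k.-bseq 'I_d).

Definition root_vertex (d k : nat) : tree d k := [bseq].

Definition is_leaf (d k : nat) (v : tree d k) : bool := size v == k.

Definition is_child (d k : nat) (u v : tree d k) : bool :=
  [exists i : 'I_d, (v : seq 'I_d) == rcons u i].

Definition adjacent (d k : nat) : rel (tree d k) :=
  fun u v => is_child u v || is_child v u.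

Definition lipschitz (V : finType) (adj : rel V) (M : nat)
    (f : {ffun V -> int}) : Prop :=
  forall u v : V, adj u v -> `|f u - f v| <= M%:Z.

Definition L (M d k : nat) : set {ffun tree d k -> int} :=
  [set f | lipschitz (@adjacent d k) M f /\
           forall v : tree d k, is_leaf v -> f v = 0].
Arguments L : clear implicits.

(* fset_set A is fset0 when A is infinite, so this is meaningful only for a
   finite nonempty A; L_finite and L_nonempty below cover the case A = L. *)
Definition uniform_pr (T : choiceType) (A E : set T) : rat :=
  #|` fset_set (A `&` E)|%:R / #|` fset_set A|%:R.

(* Pr (f(v_0) = z) for f uniform in L_M(d,k) *)
Definition pr_root (M d k : nat) (z : int) : rat :=
  uniform_pr (L M d k) [set f | f (root_vertex d k) = z].

Lemma L_bound (M d k : nat) (f : {ffun tree d k -> int}) (v : tree d k) :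
  (0 < d)%N -> L M d k f -> `|f v| <= (M * (k - size v))%:Z.
Proof.
move=> d0 [lipf leaff]; move Em : (k - size v)%N => m.
elim: m v Em => [|m IHm] v Em.
  rewrite leaff ?normr0 //.
  by rewrite /is_leaf eqn_leq size_bseq -subn_eq0 Em.
have sv : (size (rcons v (Ordinal d0)) <= k)%N.
  by rewrite size_rcons -subn_gt0 Em.
pose w : tree d k := Bseq sv.
have vw : adjacent v w.
  by apply/orP; left; apply/existsP; exists (Ordinal d0).
have fw : `|f w| <= (M * m)%:Z.
  by apply: IHm; rewrite /w /= size_rcons subnS Em.
rewrite -(subrK (f w) (f v)) mulnS PoszD.
by rewrite (le_trans (ler_normD _ _)) // lerD // lipf.
Qed.

Lemma L_finite (M d k : nat) : (0 < d)%N -> finite_set (L M d k).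
Proof.
move=> d0; pose N := (M * k)%N.
pose h (g : {ffun tree d k -> 'I_(N + N).+1}) : {ffun tree d k -> int} :=
  [ffun v => (g v)%:Z - N%:Z].
apply: (@sub_finite_set _ _ (h @` [set: {ffun tree d k -> 'I_(N + N).+1}])).
  move=> f Lf.
  have bf v : - N%:Z <= f v <= N%:Z.
    rewrite -ler_norml (le_trans (L_bound v d0 Lf)) // lez_nat.
    by rewrite leq_mul2l leq_subr orbT.
  exists [ffun v => inord (absz (f v + N%:Z))] => //.
  apply/ffunP => v; rewrite !ffunE.
  have /andP[lo hi] := bf v.
  have fN : 0 <= f v + N%:Z by rewrite -lerBlDr sub0r.
  rewrite inordK; first by rewrite gez0_abs // addrK.
  by rewrite ltnS -lez_nat gez0_abs // PoszD lerD2r.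
exact/finite_image/finite_finset.
Qed.

Lemma L_nonempty (M d k : nat) : L M d k [ffun=> 0].
Proof. by split=> [u v _|v _]; rewrite !ffunE // subrr normr0. Qed.

(* Main.v *)
(* Let w_k(i), for i >= 0, be the number of functions in L_M(d,k) with root
   value i, which is also the number of those with root value -i. Splitting at the root, w_(k+1)(i) is the d-th power of the sum
   W(i) of w_k(|z|) over the integers z with |z - i| <= M, and w_k is
   nonincreasing. Everything is a comparison of the windows i and i + M + 1.
   - If w_k(i + s) <= C w_k(i) for all i, then W(i + M + s) <= C W(i), so that
     w_(k+1)(i + M + s) <= C^d w_(k+1)(i). Iterated from s = M + 1, this gives
     the doubly exponential decay as soon as w_k(i + M + 1) <= c w_k(i).
   - For i <= M, W(i) = X + Y and W(i + M + 1) <= X + Y' where X sums w_k over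
     1..M-i, Y sums it over 0..M+i, and Y' is Y shifted by M + 1. As X <= Y, a
     contraction r for w_k yields ((1 + r) / 2)^d for w_(k+1), which is at most
     r = 1/2 when d >= 3.
   - For d = 2 this is not enough to close the induction, and one carries in
     addition the stronger factor 897/1000 for the mean over i = 0..M. With
     A the sum of w_k over 0..M, the pointwise gain is of order A (A - c X),
     and the X are at most 3/4 A on average because w_k(m) >= w_k(0) / 4 for
     m <= M.
   - The last bound holds because the window of any i <= M contains at least
     half of the window of 0. *)
From mathcomp Require Import zify ring lra.
Require Import Defs.
Set Implicit Arguments.
Unset Strict Implicit.
Unset Printing Implicit Defensive.
Import Order.TTheory GRing.Theory Num.Theory.
Local Open Scope ring_scope.

(** * Window sums of an even function on the integers *)

Section Window.
Variables (V : nmodType) (M : nat).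
Implicit Types (g : nat -> V).

(** [g] stands for the even function on the integers sending [z] to [g (absz z)]; [j = M] is the
    centre of the window. *)
Definition window g (i : nat) : V :=
  \sum_(j < M.*2.+1) g (absz ((i + j)%:Z - M%:Z)).

(** The negative part of the window folds onto [1..M-i]. *)
Lemma window_near g i : (i <= M)%N ->
  window g i = \sum_(0 <= m < M - i) g m.+1 + \sum_(0 <= m < i + M.+1) g m.
Proof.
move=> iM; rewrite /window.
rewrite -(big_mkord xpredT (fun j => g (absz ((i + j)%:Z - M%:Z)))).
rewrite (@big_cat_nat _ _ _ (M - i)) //=; last by lia.
congr (_ + _).
  rewrite big_nat_rev /=; apply: eq_big_nat => m /andP[_ mi].
  by congr g; lia.
rewrite -{1}(add0n (M - i)%N) big_addn.
have -> : (M.*2.+1 - (M - i) = i + M.+1)%N by lia.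
by apply: eq_big_nat => m _; congr g; lia.
Qed.

Lemma window_far g i : (M <= i)%N ->
  window g i = \sum_(0 <= m < M.*2.+1) g (m + (i - M))%N.
Proof.
move=> Mi; rewrite big_mkord /window; apply: eq_bigr => j _.
by congr g; lia.
Qed.

End Window.

(** * Sums with affine weights *)

Section Sums.
Variable R : realFieldType.

(* Removing the first term replaces [a] by [a - 4], and
   [(a - 2) ^+ 2 / 8 + a = (a + 2) ^+ 2 / 8]. *)
Lemma sum_affine_weight_le (h : nat -> R) (c a : R) (n : nat) :
  (forall m, (m < n)%N -> 0 <= h m <= c) -> 0 <= c ->
  \sum_(0 <= m < n) (a - 4 * m%:R) * h m <= c * (a + 2) ^+ 2 / 8.
Proof.
move=> + c0; have cq b : 0 <= c * (b + 2) ^+ 2 / 8.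
  by rewrite divr_ge0// mulr_ge0// sqr_ge0.
elim: n h a => [|n IHn] h a hc.
  by rewrite big_geq.
have [a0|a0] := leP a 0.
  apply: (@le_trans _ _ 0) => //.
  rewrite big_nat sumr_le0// => m mn; have /andP[hm _] := hc m mn.
  by rewrite mulr_le0_ge0//; have := ler0n R m; lra.
rewrite big_nat_recl//= mulr0 subr0.
have := IHn (h \o S) (a - 4) (fun m => hc m.+1).
have -> : \sum_(0 <= i < n) (a - 4 * i.+1%:R) * h i.+1 =
    \sum_(0 <= m < n) (a - 4 - 4 * m%:R) * (h \o S) m.
  by apply: eq_bigr => m _ /=; rewrite -natr1; ring.
have /andP[_ h1] := hc 0%N isT.
have := ler_wpM2l (ltW a0) h1.
lra.
Qed.

Lemma sum_affine (a : R) n :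
  \sum_(0 <= m < n) (a - 4 * m%:R) = n%:R * a - 2 * n%:R * (n%:R - 1).
Proof.
elim: n => [|n IHn]; first by rewrite big_geq//; ring.
by rewrite big_nat_recr//= IHn -natr1; ring.
Qed.

Lemma sum_prefixes (h : nat -> R) n :
  \sum_(0 <= i < n.+1) \sum_(0 <= m < i) h m =
  \sum_(0 <= m < n) (n%:R - m%:R) * h m.
Proof.
elim: n => [|n IHn]; first by rewrite !(big_nat1, big_geq).
rewrite big_nat_recr//= IHn big_nat_recr//= [in RHS]big_nat_recr//=.
rewrite addrA -big_split /=; congr (_ + _); last by rewrite -natr1; ring.
by apply: eq_bigr => m _; rewrite -natr1; ring.
Qed.

End Sums.

(** * Windows of a nonincreasing function *)

Section WindowOrder.
Variables (R : realFieldType) (M : nat) (g : nat -> R).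
Hypothesis g_ge0 : forall m, 0 <= g m.
Hypothesis g_noninc : {homo g : m n / (m <= n)%N >-> n <= m}.

Let W := window M g.

Lemma window_ge0 i : 0 <= W i.
Proof. by rewrite /W /window sumr_ge0. Qed.

Lemma window_noninc : {homo W : m n / (m <= n)%N >-> n <= m}.
Proof.
apply: homo_leq => [//|n m p nm mp|i]; first exact: le_trans mp nm.
have [iM|Mi] := ltnP i M.
  rewrite /W (window_near _ iM) (window_near _ (ltnW iM)) addSn.
  have -> : (M - i = (M - i.+1).+1)%N by lia.
  rewrite [X in _ + X <= _]big_nat_recr//= [X in _ <= X + _]big_nat_recr//=.
  have := g_noninc (_ : ((M - i.+1).+1 <= i + M.+1)%N).
  by move=> /(_ ltac:(lia)); lra.
rewrite /W !window_far//; last by lia.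
by apply: ler_sum_nat => m _; apply: g_noninc; lia.
Qed.

(** The points of the two windows are paired so that each point on the left exceeds the absolute
    value of its partner by at least [s]. *)
Lemma window_shift c s i : (forall m, g (m + s)%N <= c * g m) ->
  W (i + (M + s))%N <= c * W i.
Proof.
move=> gs; rewrite /W window_far; last by lia.
have [iM|Mi] := leqP i M; last first.
  rewrite window_far; last by lia.
  rewrite mulr_sumr; apply: ler_sum_nat => m _.
  by apply: le_trans (gs _); apply: g_noninc; lia.
rewrite window_near// [in leRHS]addrC mulrDr !mulr_sumr.
rewrite (@big_cat_nat _ _ _ (i + M.+1)) //=; last by lia.
apply: lerD.
  apply: ler_sum_nat => m _.
  by apply: le_trans (gs _); apply: g_noninc; lia.
rewrite -{1}(add0n (i + M.+1)%N) big_addn.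
have -> : (M.*2.+1 - (i + M.+1) = M - i)%N by lia.
apply: ler_sum_nat => m _.
by apply: le_trans (gs _); apply: g_noninc; lia.
Qed.

(** The window of [i + M + 1] covers [i+1..i+2M+1], which is cut at [M]. *)
Lemma window_past_near i : (i <= M)%N ->
  W (i + M.+1)%N <=
    \sum_(0 <= m < M - i) g m.+1 + \sum_(0 <= m < i + M.+1) g (m + M.+1)%N.
Proof.
move=> iM; rewrite /W window_far; last by lia.
rewrite (@big_cat_nat _ _ _ (M - i)) //=; last by lia.
apply: lerD; first by apply: ler_sum_nat => m _; apply: g_noninc; lia.
rewrite -{1}(add0n (M - i)%N) big_addn.
have -> : (M.*2.+1 - (M - i) = i + M.+1)%N by lia.
by apply: ler_sum_nat => m _; apply: g_noninc; lia.
Qed.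

Lemma near_half_le i :
  \sum_(0 <= m < M - i) g m.+1 <= \sum_(0 <= m < i + M.+1) g m.
Proof.
rewrite (@big_cat_nat _ _ _ (M - i)  0 (i + M.+1)) //=; last by lia.
rewrite -[leLHS]addr0 lerD//; last by rewrite sumr_ge0.
by apply: ler_sum_nat => m _; apply: g_noninc.
Qed.

Lemma window_half i : (i <= M)%N -> W 0 <= 2 * W i.
Proof.
move=> iM; rewrite /W !window_near// subn0 add0n.
have l1 : \sum_(0 <= m < M) g m.+1 <= \sum_(0 <= m < M.+1) g m.
  by have := near_half_le 0; rewrite subn0 add0n.
have l2 : \sum_(0 <= m < M.+1) g m <= \sum_(0 <= m < i + M.+1) g m.
  rewrite (@big_cat_nat _ _ _ M.+1  0 (i + M.+1)) //=; last by lia.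
  by rewrite lerDl sumr_ge0.
have l3 : 0 <= \sum_(0 <= m < M - i) g m.+1 by rewrite sumr_ge0.
lra.
Qed.

Lemma window_contract r i : 0 <= r <= 1 ->
  (forall m, g (m + M.+1)%N <= r * g m) ->
  W (i + M.+1)%N <= (1 + r) / 2 * W i.
Proof.
move=> /andP[r0 r1] gr; have [iM|Mi] := leqP i M.
  apply: le_trans (window_past_near iM) _; rewrite /W window_near//.
  have l1 := near_half_le i.
  have l2 : \sum_(0 <= m < i + M.+1) g (m + M.+1)%N
      <= r * \sum_(0 <= m < i + M.+1) g m.
    by rewrite mulr_sumr; apply: ler_sum_nat.
  nra.
have : W (i + M.+1)%N <= r * W i.
  rewrite /W !window_far; try lia.
  rewrite mulr_sumr; apply: ler_sum_nat => m _.
  by apply: le_trans (gr _); apply: g_noninc; lia.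
have := window_ge0 i; nra.
Qed.

(** * Squares of windows, for [d = 2] *)

Let A := \sum_(0 <= m < M.+1) g m.

Lemma near_prefix_le i : A <= \sum_(0 <= m < i + M.+1) g m.
Proof.
rewrite (@big_cat_nat _ _ _ M.+1 0 (i + M.+1)) //=; last by lia.
by rewrite lerDl sumr_ge0.
Qed.

Lemma near_half_le_prefix i : \sum_(0 <= m < M - i) g m.+1 <= A.
Proof.
rewrite /A (@big_cat_nat _ _ _ (M - i) 0 M.+1) //=; last by lia.
rewrite -[leLHS]addr0 lerD//; last by rewrite sumr_ge0.
by apply: ler_sum_nat => m _; apply: g_noninc.
Qed.

Hypothesis g_quarter : forall m, (m <= M)%N -> g 0 <= 4 * g m.
Hypothesis g_past : forall m, g (m + M.+1)%N <= 9 / 10 * g m.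
(* 897/1000 is just below the root [r] of [((1 + r) / 2) ^+ 2 = 9 / 10]. *)
Hypothesis g_past_mean :
  \sum_(0 <= m < M.+1) g (m + M.+1)%N <= 897 / 1000 * A.

(** The factor [9 / 10] alone would give [(19 / 20) ^+ 2 > 9 / 10]; using the mean factor on the
    first [M + 1] terms of Y makes up the difference. *)
Lemma window_sqr_past i : W (i + M.+1)%N ^+ 2 <= 9 / 10 * W i ^+ 2.
Proof.
have W'0 := window_ge0 (i + M.+1)%N; have W0 := window_ge0 i.
(* [1897 / 2000 = (1 + 897 / 1000) / 2], with square just below [9 / 10]. *)
suff WW : W (i + M.+1)%N <= 1897 / 2000 * W i.
  apply: (@le_trans _ _ ((1897 / 2000 * W i) ^+ 2)); last by nra.
  by rewrite ler_sqr// nnegrE// mulr_ge0//; lra.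
have [iM|Mi] := leqP i M; last first.
  have : W (i + M.+1)%N <= 9 / 10 * W i.
    rewrite /W !window_far; try lia.
    rewrite mulr_sumr; apply: ler_sum_nat => m _.
    by apply: le_trans (g_past _); apply: g_noninc; lia.
  lra.
apply: le_trans (window_past_near iM) _; rewrite /W window_near//.
have XA := near_half_le_prefix i; have AY := near_prefix_le i.
have : \sum_(0 <= m < i + M.+1) g (m + M.+1)%N <= 897 / 1000 * A
    + 9 / 10 * (\sum_(0 <= m < i + M.+1) g m - A).
  rewrite !(@big_cat_nat _ _ _ M.+1 0 (i + M.+1)) //=; try lia.
  rewrite -/A [A + _ - A]addrAC subrr add0r lerD// mulr_sumr.
  exact: ler_sum_nat.
lra.
Qed.

(** With [N = M + 1], each [g m] with [m >= 1] occurs in [N - m] of the inner sums, so the claim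
    says that the sum of [(N - 4 m) g m] over [m <= M] is at most [4 N g 0]. *)
Lemma sum_near_halves :
  4 * \sum_(0 <= i < M.+1) \sum_(0 <= m < M - i) g m.+1 <= 3 * M.+1%:R * A.
Proof.
have -> : \sum_(0 <= i < M.+1) \sum_(0 <= m < M - i) g m.+1 =
    \sum_(0 <= m < M.+1) (M.+1%:R - m%:R) * g m - M.+1%:R * g 0.
  rewrite big_nat_rev /= [in RHS]big_nat_recl//= subr0 addrC addKr.
  under eq_big_nat => i iM do rewrite add0n subSS subKn//.
  rewrite (sum_prefixes (g \o S)) /=; apply: eq_bigr => m _.
  by rewrite -!natr1; ring.
have g0 := g_ge0 0.
(* The excess of [g] over its floor [g 0 / 4] is bounded by [sum_affine_weight_le], the floor itself
   is summed exactly by [sum_affine]. *)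
have hb m : (m < M.+1)%N -> 0 <= g m - g 0 / 4 <= 3 / 4 * g 0.
  by move=> mM; have := g_quarter mM; have := g_noninc (leq0n m); lra.
have := sum_affine_weight_le M.+1%:R hb ltac:(lra).
have -> : \sum_(0 <= m < M.+1) (M.+1%:R - 4 * m%:R) * (g m - g 0 / 4) =
  \sum_(0 <= m < M.+1) (M.+1%:R - 4 * m%:R) * g m
   - g 0 / 4 * \sum_(0 <= m < M.+1) (M.+1%:R - 4 * m%:R).
  by rewrite mulr_sumr -sumrB; apply: eq_bigr => m _; ring.
rewrite sum_affine.
have -> : \sum_(0 <= m < M.+1) (M.+1%:R - 4 * m%:R) * g m =
  4 * \sum_(0 <= m < M.+1) (M.+1%:R - m%:R) * g m - 3 * M.+1%:R * A.
  by rewrite /A !mulr_sumr -sumrB; apply: eq_bigr => m _; ring.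
have N1 : 1 <= M.+1%:R :> R by rewrite ler1n.
move: (M.+1%:R) N1 => N N1.
have : g 0 * (5 / 32 * N ^+ 2 + 25 / 8 * N - 3 / 8) >= 0.
  by rewrite mulr_ge0//; nra.
lra.
Qed.

Lemma window_sqr_past_mean :
  \sum_(0 <= i < M.+1) W (i + M.+1)%N ^+ 2 <=
  897 / 1000 * \sum_(0 <= i < M.+1) W i ^+ 2.
Proof.
rewrite -subr_ge0 mulr_sumr -sumrB.
pose X i := \sum_(0 <= m < M - i) g m.+1.
have A0 : 0 <= A by rewrite sumr_ge0.
(* The summand is the lower bound for the gap at [Y = A], with [x ^+ 2] replaced by [A * x]. Its sum
   is nonnegative because [109 * 3 / 4 < 87]. *)
apply: (@le_trans _ _
    (\sum_(0 <= i < M.+1) A * (87 / 1000 * A - 109 / 1000 * X i))).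
  rewrite -mulr_sumr sumrB -(mulr_sumr _ _ X) sumr_const_nat subn0.
  rewrite mulr_ge0// -[_ *+ M.+1]mulr_natl.
  have NA : 0 <= M.+1%:R * A by rewrite mulr_ge0.
  have : 4 * \sum_(0 <= i < M.+1) X i <= 3 * M.+1%:R * A := sum_near_halves.
  lra.
apply: ler_sum_nat => i /= iM.
have := window_past_near iM; have := near_half_le i.
have := near_half_le_prefix i; have := near_prefix_le i.
have := window_ge0 (i + M.+1)%N.
have X0 : 0 <= X i by rewrite sumr_ge0.
have -> : W i = X i + \sum_(0 <= m < i + M.+1) g m by exact: window_near.
rewrite -/(X i).
have : \sum_(0 <= m < i + M.+1) g (m + M.+1)%N
    <= 9 / 10 * \sum_(0 <= m < i + M.+1) g m.
  by rewrite mulr_sumr; apply: ler_sum_nat.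
move: (\sum_(0 <= m < i + M.+1) g m) (\sum_(0 <= m < i + M.+1) _).
move: (X i) X0 (W _) => x x0 w Y Y' Y'Y w0 AY xA xY wY.
have w2 : w ^+ 2 <= (x + 9 / 10 * Y) ^+ 2.
  by rewrite ler_sqr ?nnegrE//; lra.
(* [897 / 1000 * (x + Y) ^+ 2 - (x + 9 / 10 * Y) ^+ 2] minus the target is this product plus
   [103 / 1000 * x * (A - x)]. *)
have : 0 <= (Y - A) * (87 / 1000 * (Y + A) - 6 / 1000 * x).
  by apply: mulr_ge0; lra.
have : 0 <= x * (A - x) by apply: mulr_ge0; lra.
lra.
Qed.

End WindowOrder.

(** * Counting functions by splitting at the root *)

Lemma card_fset_level (T : choiceType) (X : {fset T}) (phi : T -> int)
    (c : int) (n : nat) :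
  (\sum_(j < n) #|` [fset x in X | phi x == (c + j%:Z)%R]%fset|)%N =
  #|` [fset x in X | (c <= phi x < c + n%:Z)%R]%fset|.
Proof.
elim: n => [|n IHn].
  rewrite big_ord0; apply/esym/eqP; rewrite cardfs_eq0; apply/eqP/fsetP => x.
  by rewrite !inE /= addr0; apply/negP => /andP[_]; lia.
rewrite big_ord_recr /= IHn.
rewrite -(cardfsID [fset x in X | phi x == (c + n%:Z)%R]%fset
   [fset x in X | (c <= phi x < c + n.+1%:Z)%R]%fset) addnC.
congr (_ + _)%N; congr #|` _|; apply/fsetP => x; rewrite !inE /=;
  case: (x \in X) => //=; lia.
Qed.

Section Count.
Variables (d M : nat).

Lemma lipschitzE k (f : {ffun tree d k -> int}) :
  lipschitz (@adjacent d k) M f <->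
  forall u v : tree d k, is_child u v -> `|f u - f v| <= M%:Z.
Proof.
split=> [lf u v uv|lf u v /orP[]uv]; first by apply: lf; rewrite /adjacent uv.
  exact: lf.
by rewrite distrC; apply: lf.
Qed.

Definition branch k (f : {ffun tree d k.+1 -> int}) (i : 'I_d) :
    {ffun tree d k -> int} := [ffun v : tree d k => f (cons_bseq i v)].

Definition graft k (z : int) (h : {ffun 'I_d -> {ffun tree d k -> int}}) :
    {ffun tree d k.+1 -> int} :=
  [ffun v : tree d k.+1 =>
     if (v : seq _) is i :: _ then h i [bseq of behead v] else z].

Lemma branch_graft k z (h : {ffun 'I_d -> {ffun tree d k -> int}}) i :
  branch (graft z h) i = h i.
Proof.
by apply/ffunP => v; rewrite !ffunE /=; congr (h i _); apply: val_inj.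
Qed.

Lemma graft_root k z (h : {ffun 'I_d -> {ffun tree d k -> int}}) :
  graft z h (root_vertex d k.+1) = z.
Proof. by rewrite ffunE. Qed.

Lemma graft_branch k (f : {ffun tree d k.+1 -> int}) :
  graft (f (root_vertex d k.+1)) [ffun i => branch f i] = f.
Proof.
apply/ffunP => v; rewrite !ffunE; case: v => -[|i v] /= sv.
  by congr (f _); apply: val_inj.
by rewrite !ffunE; congr (f _); apply: val_inj.
Qed.

(** An edge of the deeper tree either joins the root to a child or lies in one branch. *)
Lemma L_branch k (f : {ffun tree d k.+1 -> int}) :
  L M d k.+1 f <->
  forall i, L M d k (branch f i) /\
    `|f (root_vertex d k.+1) - branch f i (root_vertex d k)| <= M%:Z.
Proof.
split=> [[/lipschitzE lf zf] i|bf].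
  split; last first.
    rewrite !ffunE; apply: lf; apply/existsP; exists i; exact: eqxx.
  split=> [|v lv]; last by rewrite ffunE zf// /is_leaf /= eqSS.
  apply/lipschitzE => u v /existsP[j /eqP uv]; rewrite !ffunE; apply: lf.
  by apply/existsP; exists j; rewrite /= uv.
split=> [|v]; last first.
  rewrite -(graft_branch f) ffunE; case: v => -[|i v] //= sv.
  rewrite /is_leaf/= eqSS => lv; rewrite ffunE.
  by have [[_ zf] _] := bf i; apply: zf.
apply/lipschitzE => u v /existsP[j /eqP uv].
rewrite -(graft_branch f) !ffunE.
case: u v uv => -[|i u] su [[|i' v] sv] //= [].
  move=> -> v0; rewrite ffunE; have [_] := bf j.
  by congr (`|_ - branch f j _| <= _); apply: val_inj; rewrite /= v0.
move=> -> uv; rewrite ffunE.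
have [[/lipschitzE lb _] _] := bf i.
by apply: lb; apply/existsP; exists j; rewrite /= uv.
Qed.

Hypothesis d_gt0 : (0 < d)%N.

Let F k := fset_set (L M d k).

Definition rooted_at k (z : int) : {fset {ffun tree d k -> int}} :=
  [fset f in F k | f (root_vertex d k) == z]%fset.

Lemma in_fset_set_L k f : (f \in F k) = (f \in L M d k).
Proof. by rewrite in_fset_set//; exact: L_finite. Qed.

Lemma card_near k (z : int) :
  #|` [fset f in F k | (`|z - f (root_vertex d k)| <= M%:Z)%R]%fset| =
  (\sum_(j < M.*2.+1) #|` rooted_at k (z - M%:Z + j%:Z)|)%N.
Proof.
rewrite card_fset_level; congr #|` _|; apply/fsetP => f; rewrite !inE /=.
by case: (f \in F k) => //=; lia.
Qed.

(** The [d] branches are chosen independently among the functions whose root value is within [M] of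
    [z]; [gr] is the resulting bijection. *)
Lemma card_rooted_at k (z : int) :
  #|` rooted_at k.+1 z| =
  ((\sum_(j < M.*2.+1) #|` rooted_at k (z - M%:Z + j%:Z)|) ^ d)%N.
Proof.
rewrite -card_near; set U := [fset f in F k | _]%fset.
pose gr (h : {ffun 'I_d -> U}) := graft z [ffun i => val (h i)].
have -> : rooted_at k.+1 z = [fset gr h | h in {ffun 'I_d -> U}]%fset.
  apply/fsetP => f; rewrite !inE /= in_fset_set_L; apply/idP/idP.
    move=> /andP[/set_mem/L_branch Lf /eqP fz].
    have bU i : branch f i \in U.
      by have [? ?] := Lf i; rewrite !inE in_fset_set_L /= mem_set// -fz.
    apply/imfsetP; exists [ffun i => [` bU i]%fset] => //.
    rewrite /gr -[LHS]graft_branch fz; congr (graft z _).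
    by apply/ffunP => i; rewrite !ffunE.
  move=> /imfsetP[h _ ->]; rewrite graft_root eqxx andbT mem_set//.
  apply/L_branch => i; rewrite branch_graft graft_root ffunE.
  have := valP (h i); rewrite !inE in_fset_set_L => /andP[/set_mem]; by split.
rewrite card_imfset /=; last first.
  move=> h1 h2 /(congr1 (fun f => branch f)) E; apply/ffunP => i.
  apply: val_inj; have := congr1 (fun b => b i) E.
  by rewrite /gr !branch_graft !ffunE.
by rewrite -cardE card_ffun card_ord -cardfE.
Qed.

End Count.

(** * The recursion for root counts and its decay *)

Section Weight.
Variables (R : realFieldType) (d M : nat).

(** This is w_k, as [card_rooted_weight] confirms; at depth 0 the root is a leaf, so only the value
    0 occurs. *)
Fixpoint weight (k : nat) : nat -> R :=
  if k is k'.+1 then fun i => window M (weight k') i ^+ d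
  else fun i => (i == 0)%:R.

Lemma weightS k i : weight k.+1 i = window M (weight k) i ^+ d.
Proof. by []. Qed.

Lemma weight_ge0 k i : 0 <= weight k i.
Proof. by elim: k i => [|k IHk] i /=; rewrite ?exprn_ge0 ?window_ge0. Qed.

Lemma weight_noninc k : {homo weight k : m n / (m <= n)%N >-> n <= m}.
Proof.
elim: k => [|k IHk] m n mn /=; first by rewrite ler_nat; lia.
rewrite lerXn2r ?nnegrE ?window_ge0//; try exact: weight_ge0.
by apply: window_noninc => //; exact: weight_ge0.
Qed.

Lemma weight_near k i : (i <= M)%N -> weight k.+1 0 <= 2 ^+ d * weight k.+1 i.
Proof.
have g0 := weight_ge0 k => iM /=; rewrite -exprMn lerXn2r ?nnegrE ?mulr_ge0//.
- exact: window_ge0.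
- exact: window_ge0.
- exact/window_half/iM/weight_noninc.
Qed.

Hypothesis d_gt0 : (0 < d)%N.

(** At depth 1 the children of the root are leaves. This starts the decay estimates below. *)
Lemma weight1_past i : (M < i)%N -> weight 1 i = 0.
Proof.
move=> Mi /=; rewrite window_far; last by lia.
rewrite big_nat big1 ?expr0n ?gtn_eqF// => m _.
by case: eqP => //; lia.
Qed.

Lemma weight1_past_le (c : R) i s : 0 <= c -> (M < s)%N ->
  weight 1 (i + s)%N <= c * weight 1 i.
Proof.
by move=> c0 Ms; rewrite weight1_past ?mulr_ge0 ?weight_ge0 1?ltn_addl.
Qed.

Lemma weight_past_iter (c : R) : 0 <= c ->
  (forall k i, weight k.+1 (i + M.+1)%N <= c * weight k.+1 i) ->
  forall j k i,
    weight k.+1 (i + (j.+1 * M).+1)%N <= c ^+ (d ^ j)%N * weight k.+1 i.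
Proof.
move=> c0 cM; elim=> [|j IHj] k i; first by rewrite mul1n expr1.
case: k => [|k].
  by apply: weight1_past_le; rewrite ?exprn_ge0// mulSn; lia.
rewrite !(weightS k.+1) expnSr exprM -exprMn.
have g0 := weight_ge0 k.+1; have gd := @weight_noninc k.+1.
rewrite lerXn2r ?nnegrE ?mulr_ge0 ?exprn_ge0//; try exact: window_ge0.
have -> : (i + (j.+2 * M).+1 = i + (M + (j.+1 * M).+1))%N by lia.
exact: window_shift (IHj k).
Qed.

Lemma weight_past_ge3 : (3 <= d)%N ->
  forall k i, weight k.+1 (i + M.+1)%N <= (3 / 4) ^+ d * weight k.+1 i.
Proof.
move=> d3; have q0 : 0 <= 3 / 4 :> R by lra.
(* [(3 / 4) ^+ 3 = 27 / 64 < 1 / 2]. *)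
have c_le : (3 / 4) ^+ d <= 1 / 2 :> R.
  rewrite -(subnKC d3) exprD.
  have : (3 / 4) ^+ (d - 3) <= 1 :> R by rewrite exprn_ile1//; lra.
  have : 0 <= (3 / 4) ^+ (d - 3) :> R by rewrite exprn_ge0.
  by rewrite !exprS expr0; lra.
elim=> [|k IHk] i.
  by apply: weight1_past_le; rewrite // exprn_ge0.
have g0 := weight_ge0 k.+1; have gd := @weight_noninc k.+1.
rewrite !(weightS k.+1) -exprMn.
rewrite lerXn2r ?nnegrE ?(mulr_ge0 q0) ?window_ge0//.
have qE : (1 + 1 / 2) / 2 = 3 / 4 :> R by lra.
rewrite -qE; apply: window_contract => // [|m]; first by lra.
by apply: le_trans (IHk m) _; rewrite ler_wpM2r.
Qed.

End Weight.

Lemma weight_past_2 (R : realFieldType) M k i :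
  weight R 2 M k.+1 (i + M.+1)%N <= 9 / 10 * weight R 2 M k.+1 i.
Proof.
suff [] : (forall i, weight R 2 M k.+1 (i + M.+1)%N
      <= 9 / 10 * weight R 2 M k.+1 i) /\
    \sum_(0 <= m < M.+1) weight R 2 M k.+1 (m + M.+1)%N
      <= 897 / 1000 * \sum_(0 <= m < M.+1) weight R 2 M k.+1 m by [].
elim: k {i} => [|k [IHp IHm]].
  split=> [i|].
    by apply: weight1_past_le => //; lra.
  rewrite big1 => [|m _]; last by rewrite weight1_past//; lia.
  by rewrite mulr_ge0 ?sumr_ge0//; [lra | move=> m _; exact: weight_ge0].
have g0 := weight_ge0 R 2 M k.+1; have gd := @weight_noninc R 2 M k.+1.
have gq m : (m <= M)%N -> weight R 2 M k.+1 0 <= 4 * weight R 2 M k.+1 m.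
  by move=> /(weight_near R 2 k); rewrite -natrX.
split=> [i|].
  exact: window_sqr_past.
exact: window_sqr_past_mean.
Qed.

Lemma card_rooted_weight (R : realFieldType) (d M k : nat) (z : int) :
  (0 < d)%N -> #|` rooted_at d M k z|%:R = weight R d M k (absz z).
Proof.
move=> d0; elim: k z => [|k IHk] z.
  have -> : rooted_at d M 0 z =
      if z == 0 then [fset [ffun=> 0]]%fset else fset0.
    have L0 f : (f \in L M d 0) = (f == [ffun=> 0]).
      apply/idP/eqP => [/set_mem[_ zf]|->]; last exact/mem_set/L_nonempty.
      apply/ffunP => v; rewrite ffunE zf// /is_leaf.
      by have := size_bseq v; rewrite leqn0.
    apply/fsetP => f; rewrite !inE /= in_fset_set_L// L0.
    case: eqP => [->|/eqP/negbTE fz]; last by case: ifP; rewrite inE.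
    by rewrite ffunE eq_sym; case: ifP; rewrite inE ?eqxx.
  by rewrite /= absz_eq0; case: eqP => _; rewrite ?cardfs1 ?cardfs0.
rewrite card_rooted_at// natrX natr_sum /=; congr (_ ^+ d).
under eq_bigr => j _ do rewrite IHk.
(* For negative [z] the window of [absz z] is the mirror image, so the index is reversed. *)
case: (lerP 0 z) => z0; last rewrite (reindex_inj rev_ord_inj) /=.
  by apply: eq_bigr => j _; congr (weight _ _ _ _ _); lia.
apply: eq_bigr => j _; congr (weight _ _ _ _ _).
by have := ltn_ord j; rewrite /= subSS; lia.
Qed.

(** * From counts to probabilities *)

Theorem theorem1p1 (d M k : nat) (hd : (2 <= d)%N) (hM : (1 <= M)%N)
    (hk : (1 <= k)%N) :
  (forall t : nat, (1 <= t)%N ->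
     pr_root M d k (M + t)%N%:Z
       <= (9 / 10) ^+ (d ^ ((t - 1) %/ M))%N * pr_root M d k 0) /\
  ((3 <= d)%N ->
   forall t : nat, (1 <= t)%N ->
     pr_root M d k (M + t)%N%:Z
       <= ((3 / 4) ^+ d) ^+ (d ^ ((t - 1) %/ M))%N * pr_root M d k 0) /\
  pr_root M d k 0 <= 1 / (1 + 2 ^ (1 - d%:Z) * M%:R).
Proof.
have d0 : (0 < d)%N by lia.
case: k hk => // k _.
pose T : rat := #|` fset_set (L M d k.+1)|%:R.
have prE z : pr_root M d k.+1 z = weight rat d M k.+1 (absz z) / T.
  rewrite /pr_root /uniform_pr -card_rooted_weight//; congr (_%:R / _).
  congr #|` _|; apply/fsetP => f; rewrite !inE /= in_fset_set_L//.
  rewrite in_fset_set; last exact/finite_setIl/L_finite.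
  by rewrite in_setI; congr andb; apply/idP/eqP => [/set_mem|/mem_set].
have T0 : 0 <= T by [].
have past (c : rat) : 0 <= c ->
    (forall k i,
       weight rat d M k.+1 (i + M.+1)%N <= c * weight rat d M k.+1 i) ->
    forall t, (1 <= t)%N -> pr_root M d k.+1 (M + t)%N%:Z
      <= c ^+ (d ^ ((t - 1) %/ M))%N * pr_root M d k.+1 0.
  move=> c0 cM t t1; rewrite !prE mulrA ler_wpM2r ?invr_ge0//=.
  (* With [j = (t - 1) %/ M], [j * M <= t - 1] gives [(j + 1) * M + 1 <= M + t]. *)
  apply: le_trans (weight_past_iter d0 c0 cM _ k 0).
  apply: weight_noninc; rewrite add0n mulSn.
  by have := leq_trunc_div (t - 1) M; lia.
have ge3 := @weight_past_ge3 rat d M d0.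
split; first apply: past => [//|k' i].
  have [d3|d2] := leqP 3 d; last first.
    have -> : d = 2 by lia.
    exact: weight_past_2.
  (* For [d >= 3] the factor is at most [27 / 64 <= 9 / 10]. *)
  apply: le_trans (ge3 d3 k' i) _; rewrite ler_wpM2r ?weight_ge0//.
  rewrite -(subnKC d3) exprD.
  have : (3 / 4) ^+ (d - 3) <= 1 :> rat by rewrite exprn_ile1.
  by rewrite !exprS expr0; lra.
split=> [d3|]; first exact: past (exprn_ge0 _ _) (ge3 d3).
rewrite prE; set a := weight _ _ _ _ _.
have two0 : 0 < 2 ^+ d :> rat by rewrite exprn_gt0.
have -> : 2 ^ (1 - d%:Z) = 2 / 2 ^+ d :> rat.
  by rewrite expfzDr// expr1z exprnN.
(* Only root values in [[-M, M]] are counted: 0, at index [j = M], gives [a], and each of the other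
   [2M] values gives at least [a / 2 ^+ d]. *)
have TE : a * (1 + 2 / 2 ^+ d * M%:R) <= T.
  apply: (@le_trans _ _ (\sum_(j < M.*2.+1)
      #|` rooted_at d M k.+1 (- M%:Z + j%:Z)|%:R)).
    under eq_bigr => j _ do rewrite card_rooted_weight//.
    rewrite (bigD1 (inord M)) //= inordK; last by lia.
    rewrite addNr mulrDr mulr1 lerD//.
    apply: (@le_trans _ _ (\sum_(j < M.*2.+1 | j != inord M) a / 2 ^+ d)).
      rewrite sumr_const cardC1 card_ord /= -muln2 mulrnA -[_ *+ M]mulr_natr.
      by rewrite le_eqVlt; apply/orP; left; apply/eqP; ring.
    apply: ler_sum => j _; rewrite ler_pdivrMr// mulrC.
    by apply: weight_near; have := ltn_ord j; lia.
  rewrite -natr_sum card_fset_level ler_nat; apply: fsubset_leq_card.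
  by apply/fsubsetP => f; rewrite inE => /andP[].
have Tp : 0 < T.
  rewrite ltr0n cardfs_gt0; apply/fset0Pn; exists [ffun=> 0].
  by rewrite in_fset_set ?mem_set//; [exact: L_nonempty | exact: L_finite].
rewrite ler_pdivrMr// mul1r ler_pdivlMl//.
  by rewrite mulrC.
by rewrite ltr_wpDr// mulr_ge0// divr_ge0// ltW.
Qed.
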